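(* Let $f_0\ge0$ satisfy $\int_{\mathbb{R}^3}f_0\,dv=1$, $\int_{\mathbb{R}^3}f_0(v)v\,dv=0$ and $\int_{\mathbb{R}^3}f_0(v)|v|^2dv<\infty$. Let $\mathrm{e}\in(0,1)$ be a constant restitution coefficient ($e(r)=\mathrm{e}$ for all $r\ge0$) such that $$\frac{3(1-\mathrm{e}^2)}8<1-\kappa_{3/2},\qquad \kappa_{3/2}:=\int_0^1\left[\left(\frac{3+s}4\right)^{3/2}+\left(\frac{1-s}4\right)^{3/2}\right]ds,$$ and let $f(t,v)$ be the solution to the inelastic Boltzmann equation $\partial_tf=\mathcal{Q}_e(f,f)$, $f(0,\cdot)=f_0$. Then Haff's law holds: there exist constants $c,C>0$ such that $$c\,(1+t)^{-2}\le\int_{\mathbb{R}^3}f(t,v)|v|^2\,dv\le C\,(1+t)^{-2}\qquad\forall t\ge0.$$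
   Context: Inelastic hard-sphere collisions: for $v,v_\star\in\mathbb{R}^3$ and $n\in\mathbb{S}^2$ put $u=v-v_\star$; with constant restitution coefficient $\mathrm{e}$, the post-collision velocities are $v'=v-\frac{1+\mathrm{e}}{2}(u\cdot n)n$, $v_\star'=v_\star+\frac{1+\mathrm{e}}{2}(u\cdot n)n$. The collision operator $\mathcal{Q}_e$ is defined in weak form, for smooth test functions $\psi$, by $$\int_{\mathbb{R}^3}\mathcal{Q}_e(f,f)\psi\,dv=\frac1{2\pi}\int_{\mathbb{R}^3\times\mathbb{R}^3\times\mathbb{S}^2}|u\cdot n|f(v)f(v_\star)\big(\psi(v')+\psi(v_\star')-\psi(v)-\psi(v_\star)\big)\,dv\,dv_\star\,dn.$$ The Cauchy problem is spatially homogeneous and known to be well-posed for nonnegative $f_0$ of unit mass, zero momentum and finite energy; its solution is nonnegative, conserves mass and momentum, and its energy $\mathcal{E}(t)=\int f(t,v)|v|^2dv$ satisfies $\frac{d}{dt}\mathcal{E}(t)=-\frac{1-\mathrm{e}^2}8\int_{\mathbb{R}^3\times\mathbb{R}^3}f(t,v)f(t,v_\star)|v-v_\star|^3\,dv\,dv_\star$. *)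

(* Defs.v *)
From HB Require Import structures.
From mathcomp Require Import all_boot all_order all_algebra.
From mathcomp Require Import all_classical all_reals all_analysis.

Set Implicit Arguments.
Unset Strict Implicit.
Unset Printing Implicit Defensive.

Import Order.TTheory GRing.Theory Num.Theory.
Import numFieldNormedType.Exports.

Local Open Scope classical_set_scope.
Local Open Scope ring_scope.

(* The space R^3, with the componentwise vector space structure, the product
   topology and the product (Borel) sigma-algebra.  The norm that the library
   puts on a product is the max norm, so the Euclidean structure is given by
   dot3 and sqnorm3. *)
Notation R3 R := (R * R * R)%type.

(* The library proves this fact inside a section, but the canonical instance
   that it derives from it is shadowed by the one for subprobabilities. *)
Lemma product_sigma_finite (R : realType) (d1 d2 : measure_display)
    (T1 : measurableType d1) (T2 : measurableType d2)
    (m1 : {sigma_finite_measure set T1 -> \bar R})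
    (m2 : {sigma_finite_measure set T2 -> \bar R}) :
  sigma_finite setT (m1 \x m2)%E.
Proof.
have /sigma_finiteP[F [TF ndF Foo]] := sigma_finiteT m1.
have /sigma_finiteP[G [TG ndG Goo]] := sigma_finiteT m2.
exists (fun n => F n `*` G n).
  rewrite -setXTT TF TG predeqE => -[x y]; split.
    move=> [/= [n _ Fnx] [k _ Gky]]; exists (maxn n k) => //; split.
    - by move: x Fnx; exact/subsetPset/ndF/leq_maxl.
    - by move: y Gky; exact/subsetPset/ndG/leq_maxr.
  by move=> [n _ []/= ? ?]; split; exists n.
move=> k; have [? ?] := Foo k; have [? ?] := Goo k.
split; first exact: measurableX.
by rewrite product_measure1E// lte_mul_pinfty// ge0_fin_numE.
Qed.

Section LebesgueMeasures.
Context {R : realType}.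

Definition lebesgue2 := (@lebesgue_measure R \x @lebesgue_measure R)%E.

HB.instance Definition _ := Measure.on lebesgue2.
HB.instance Definition _ := Measure_isSigmaFinite.Build _ _ _ lebesgue2
  (product_sigma_finite _ _).

Definition lebesgue3 := (lebesgue2 \x @lebesgue_measure R)%E.

HB.instance Definition _ := Measure.on lebesgue3.
HB.instance Definition _ := Measure_isSigmaFinite.Build _ _ _ lebesgue3
  (product_sigma_finite _ _).

Definition lebesgue33 := (lebesgue3 \x lebesgue3)%E.

HB.instance Definition _ := Measure.on lebesgue33.
HB.instance Definition _ := Measure_isSigmaFinite.Build _ _ _ lebesgue33
  (product_sigma_finite _ _).

(* dv dv_star dtheta dphi *)
Definition collision_measure := (lebesgue33 \x lebesgue2)%E.

HB.instance Definition _ := Measure.on collision_measure.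
HB.instance Definition _ := Measure_isSigmaFinite.Build _ _ _
  collision_measure (product_sigma_finite _ _).

End LebesgueMeasures.

Section Space.
Context {R : realType}.
Implicit Types (u v : R3 R) (g psi : R3 R -> R).

Definition dot3 u v : R :=
  u.1.1 * v.1.1 + u.1.2 * v.1.2 + u.2 * v.2.

Definition sqnorm3 v : R := dot3 v v.

(* The unit sphere in spherical coordinates a = (theta, phi), with
   0 <= theta <= pi and 0 <= phi <= 2 pi; its surface measure is
   dn = sin(theta) dtheta dphi. *)
Definition sphere_pt (a : R * R) : R3 R :=
  (sin a.1 * cos a.2, sin a.1 * sin a.2, cos a.1).

Definition sphere_dom : set (R * R) := `[0, pi] `*` `[0, 2 * pi].

Definition sphere_jac (a : R * R) : R := sin a.1.

Fixpoint Ck (k : nat) psi : Prop :=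
  if k is k'.+1 then
    [/\ continuous psi,
        (forall x h, derivable psi x h) &
        (forall h, Ck k' (fun x => 'D_h psi x))]
  else continuous psi.

Definition smooth psi : Prop := forall k, Ck k psi.

(* Smooth functions of at most quadratic growth: those for which the integral
   of f psi makes sense for every f of finite mass and energy.  They include
   1, the coordinates of v and |v|^2. *)
Definition test_function psi : Prop :=
  smooth psi /\ exists C : R, forall v, `|psi v| <= C * (1 + sqnorm3 v).

Definition mass g : \bar R := (\int[lebesgue3]_v (g v)%:E)%E.

Definition energy g : \bar R := (\int[lebesgue3]_v (g v * sqnorm3 v)%:E)%E.

Definition momentum g : R3 R :=
  (\int[lebesgue3]_v (g v * v.1.1), \int[lebesgue3]_v (g v * v.1.2),
   \int[lebesgue3]_v (g v * v.2)).

End Space.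

Section Collision.
Context {R : realType} (e : R).
Implicit Types (v w n : R3 R) (f psi : R3 R -> R).

(* The post-collision velocities v' and v_star' for w = v_star. *)
Definition post1 v w n : R3 R := v - ((1 + e) / 2 * dot3 (v - w) n) *: n.

Definition post2 v w n : R3 R := w + ((1 + e) / 2 * dot3 (v - w) n) *: n.

Definition collision_dom : set (R3 R * R3 R * (R * R)) :=
  setT `*` sphere_dom.

(* The integrand of the weak form at z = ((v, v_star), a), for
   n = sphere_pt a; the factor sphere_jac a belongs to dn. *)
Definition collision_integrand f psi (z : R3 R * R3 R * (R * R)) : R :=
  let v := z.1.1 in let w := z.1.2 in let n := sphere_pt z.2 in
  `|dot3 (v - w) n| * f v * f w *
  (psi (post1 v w n) + psi (post2 v w n) - psi v - psi w) *
  sphere_jac z.2.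

Definition weakQ f psi : R :=
  (2 * pi)^-1 *
  \int[collision_measure]_(z in collision_dom) collision_integrand f psi z.

(* Finite-energy weak solutions of d/dt f = Q_e(f, f), f(0, .) = f0.  No third
   moment of f0 is assumed, so the derivative of the energy may be infinite at
   t = 0: the equation is required for t > 0, together with continuity on
   [0, +oo[.  Integrability of the collision integrand is required explicitly
   because Rintegral is a total function.  Conservation of mass and momentum
   and the dissipation of energy are the cases psi = 1, v_i, |v|^2. *)
Definition boltzmann_solution (f0 : R3 R -> R) (f : R -> R3 R -> R) : Prop :=
  [/\ forall t, 0 <= t ->
        [/\ forall v, 0 <= f t v,
            lebesgue3.-integrable setT (EFin \o f t) &
            (energy (f t) < +oo)%E],
      {ae lebesgue3, forall v, f 0 v = f0 v} &
      forall psi, test_function psi ->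
        {within `[0, +oo[, continuous
           (fun t : R => \int[lebesgue3]_v (f t v * psi v))} /\
        (forall t : R, 0 < t ->
           collision_measure.-integrable collision_dom
             (EFin \o collision_integrand (f t) psi) /\
           is_derive t 1 (fun s : R => \int[lebesgue3]_v (f s v * psi v))
             (weakQ (f t) psi))].

End Collision.

Definition kappa32 (R : realType) : R :=
  \int[@lebesgue_measure R]_(s in `[0, 1])
    (((3 + s) / 4) `^ (3 / 2) + ((1 - s) / 4) `^ (3 / 2)).

(* Main.v *)
(* Both bounds rest on closed differential inequalities for moments of f.

   Lower bound.  Since v' + v_star' = v + v_star, the triangle inequality gives
   |v'| + |v_star'| >= |v + v_star| >= |v| + |v_star| - 2 min(|v|, |v_star|),
   and |u . n| min(|v|, |v_star|) <= 2 |v| |v_star|.  Hence the first moment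
   m(t) = \int f |v| satisfies m' >= - 8 m^2, so that m >= c / (1 + t), and
   energy >= m^2 by the Cauchy-Schwarz inequality.  As |v| is not smooth, it is
   replaced by sqrt(d^2 + |v|^2), the norm of (v, d) in R^4, for which the same
   inequalities hold, and d tends to 0 at the end.

   Upper bound.  For s >= 0 one has |u . n|^3 >= (3 s (u . n)^2 - s^3) / 2, and
   the average of (u . n)^2 over the sphere is |u|^2 / 3.  With unit mass and
   zero momentum this bounds the energy dissipation from below by
   k (2 s E - s^3), k = (1 - e^2) / 2, for every s >= 0.  The choice
   s = 2 / (k (1 + t)) makes (1 + t)^4 (E - C / (1 + t)^2) nonincreasing. *)
Require Import Defs.
From HB Require Import structures.
From mathcomp Require Import all_boot all_order all_algebra.
From mathcomp Require Import all_classical all_reals all_analysis.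
From mathcomp Require Import measurable_realfun.
From mathcomp Require Import ring lra.

Set Implicit Arguments.
Unset Strict Implicit.
Unset Printing Implicit Defensive.

Import Order.TTheory GRing.Theory Num.Theory.
Import numFieldNormedType.Exports.

Local Open Scope classical_set_scope.
Local Open Scope ring_scope.

(* Pairing integrability with the value of the integral makes the predicate
   stable under sums, scalings and products of independent variables. *)
Definition has_Rintegral d (T : measurableType d) (R : realType)
    (mu : {measure set T -> \bar R}) (D : set T) (f : T -> R) (I : R) : Prop :=
  [/\ measurable D, mu.-integrable D (EFin \o f) & \int[mu]_(x in D) f x = I].

(** * Linearity and monotonicity of integrals of integrable functions *)

Section HasRintegral.
Context {R : realType} (d : measure_display) (T : measurableType d).
Variables (mu : {measure set T -> \bar R}) (D : set T).
Implicit Types f g : T -> R.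

Lemma eq_has_Rintegral f g I :
  f =1 g -> has_Rintegral mu D f I -> has_Rintegral mu D g I.
Proof. by move=> /funext ->. Qed.

Lemma has_RintegralD f g I J : has_Rintegral mu D f I ->
  has_Rintegral mu D g J -> has_Rintegral mu D (fun x => f x + g x) (I + J).
Proof.
move=> [mD fi <-] [_ gi <-]; split=> //; last by rewrite RintegralD.
by have := integrableD mD fi gi.
Qed.

Lemma has_RintegralZ k f I :
  has_Rintegral mu D f I -> has_Rintegral mu D (fun x => k * f x) (k * I).
Proof.
move=> [mD fi <-]; split=> //; last by rewrite RintegralZl.
by have := integrableZl mD k fi.
Qed.

Lemma has_RintegralB f g I J : has_Rintegral mu D f I ->
  has_Rintegral mu D g J -> has_Rintegral mu D (fun x => f x - g x) (I - J).
Proof.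
move=> [mD fi <-] [_ gi <-]; split=> //; last by rewrite RintegralB.
by have := integrableB mD fi gi.
Qed.

Lemma has_Rintegral0 : measurable D -> has_Rintegral mu D (fun=> 0) 0.
Proof.
split=> //; first exact: integrable0.
by rewrite /Rintegral integral0_eq.
Qed.

Lemma has_Rintegral_sum (I : Type) (s : seq I) (h : I -> T -> R) (c : I -> R) :
  measurable D -> (forall i, has_Rintegral mu D (h i) (c i)) ->
  has_Rintegral mu D (fun x => \sum_(i <- s) h i x) (\sum_(i <- s) c i).
Proof.
move=> mD hc; elim: s => [|i s IH].
  rewrite big_nil; apply: eq_has_Rintegral (has_Rintegral0 mD) => x.
  by rewrite big_nil.
rewrite big_cons; apply: eq_has_Rintegral (has_RintegralD (hc i) IH) => x.
by rewrite big_cons.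
Qed.

Lemma le_has_Rintegral f g I J : has_Rintegral mu D f I ->
  has_Rintegral mu D g J -> (forall x, D x -> f x <= g x) -> I <= J.
Proof. by move=> [mD fi <-] [_ gi <-] fg; exact: le_Rintegral. Qed.

End HasRintegral.

(** * Fubini's theorem for products of functions of separate variables *)

Section ProductIntegrals.
Context {R : realType} (d1 d2 : measure_display).
Context (T1 : measurableType d1) (T2 : measurableType d2).
Variable m1 : {sigma_finite_measure set T1 -> \bar R}.
Variable m2 : {sigma_finite_measure set T2 -> \bar R}.
Implicit Types (F : T1 -> R) (G : T2 -> R).

(** By Tonelli it suffices that the iterated integral of [|F x * G y|] is finite, and it factors
    into the two norms of [F] and [G]. *)
Lemma integrable_prodT F G :
  m1.-integrable setT (EFin \o F) -> m2.-integrable setT (EFin \o G) ->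
  (m1 \x m2)%E.-integrable setT (fun z => (F z.1 * G z.2)%:E).
Proof.
move=> iF iG; apply/integrable12ltyP.
  apply/measurable_EFinP/measurable_funM.
  - apply: measurableT_comp => //; exact/measurable_EFinP/measurable_int/iF.
  - apply: measurableT_comp => //; exact/measurable_EFinP/measurable_int/iG.
have nG := integrable_norm iG; have nF := integrable_norm iF.
have cE : (\int[m2]_y `|G y|%:E)%E = (\int[m2]_y `|G y|)%:E.
  by rewrite fineK//; exact: integrable_fin_num.
have -> : (\int[m1]_x \int[m2]_y `|(F x * G y)%:E|)%E =
    (\int[m1]_x (`|F x|%:E * (\int[m2]_y `|G y|)%:E))%E.
  apply: eq_integral => x _; rewrite -cE -ge0_integralZl//.
  - by apply: eq_integral => y _; rewrite -EFinM -normrM.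
  - by case/integrableP: nG.
rewrite (integralZr _ nF)// lte_mul_pinfty//.
- by apply: integral_ge0 => x _; rewrite lee_fin normr_ge0.
- exact: integrable_fin_num.
- exact: ltry.
Qed.

Lemma Rintegral_prodT F G :
  m1.-integrable setT (EFin \o F) -> m2.-integrable setT (EFin \o G) ->
  \int[(m1 \x m2)%E]_z (F z.1 * G z.2) = (\int[m1]_x F x) * \int[m2]_y G y.
Proof.
move=> iF iG; rewrite /Rintegral.
rewrite -(integral12_prod_meas1 (integrable_prodT iF iG)) /fubini_F /=.
rewrite -fineM; [|exact: integrable_fin_num|exact: integrable_fin_num].
have cE : (\int[m2]_y (G y)%:E)%E = (\int[m2]_y G y)%:E.
  by rewrite fineK//; exact: integrable_fin_num.
congr fine; rewrite cE -(integralZr _ iF)//; apply: eq_integral => x _.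
by rewrite -cE -(integralZl _ iG)//; apply: eq_integral => y _; rewrite -EFinM.
Qed.

(** Extension by zero respects products, so an integral over a rectangle becomes one over the whole
    product space, where Fubini has just been established. *)
Lemma restrict_prod (A : set T1) (B : set T2) F G :
  (fun z => F z.1 * G z.2) \_ (A `*` B) =
  (fun z => (F \_ A) z.1 * (G \_ B) z.2).
Proof.
apply/funext => -[x y] /=; rewrite !patchE in_setX /=.
by case: (x \in A); case: (y \in B); rewrite /= ?mulr0 ?mul0r.
Qed.

Lemma has_Rintegral_prod (A : set T1) (B : set T2) F G I J :
  has_Rintegral m1 A F I -> has_Rintegral m2 B G J ->
  has_Rintegral (m1 \x m2)%E (A `*` B) (fun z => F z.1 * G z.2) (I * J).
Proof.
move=> [mA /(integrable_mkcond _ mA) iF <-] [mB /(integrable_mkcond _ mB) iG <-].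
rewrite !restrict_EFin in iF iG; split; first exact: measurableX.
  apply/integrable_mkcond; first exact: measurableX.
  by rewrite restrict_EFin restrict_prod; exact: integrable_prodT.
rewrite [LHS]Rintegral_mkcond restrict_prod Rintegral_prodT//.
by rewrite -!Rintegral_mkcond.
Qed.

End ProductIntegrals.

(** * Area and second moments of the unit sphere in spherical coordinates *)

Section SphereIntegrals.
Context {R : realType}.
Notation mu := (@lebesgue_measure R).

Lemma has_Rintegral_FTC2 (f F : R -> R) (a b I : R) : a < b -> continuous f ->
  (forall x : R, is_derive x 1 F (f x)) -> F b - F a = I ->
  has_Rintegral mu `[a, b] f I.
Proof.
move=> ab cf dF <-; split=> //.
  apply: continuous_compact_integrable; first exact: segment_compact.
  exact: continuous_subspaceT.
have cF : continuous F.
  by move=> x; apply/differentiable_continuous/derivable1_diffP; case: (dF x).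
rewrite /Rintegral (@continuous_FTC2 _ f F)//.
- exact: continuous_subspaceT.
- split.
  + by move=> x _; case: (dF x).
  + exact/cvg_at_right_filter/cF.
  + exact/cvg_at_left_filter/cF.
- by move=> x _; rewrite derive1E; exact: derive_val.
Qed.

Local Ltac continuous_trig :=
  move=> ?; do !apply: cvgM;
  do ?[exact: continuous_sin|exact: continuous_cos|exact: cvg_cst].

Lemma polar_sin : has_Rintegral mu `[0, pi] sin 2.
Proof.
apply: (has_Rintegral_FTC2 (F := fun x => - cos x)).
- exact: pi_gt0.
- exact: continuous_sin.
- by move=> x; have := is_deriveN (is_derive_cos x); rewrite opprK.
- by rewrite cospi cos0; ring.
Qed.

Lemma polar_cos2sin :
  has_Rintegral mu `[0, pi] (fun x => cos x * cos x * sin x) (2 / 3).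
Proof.
apply: (has_Rintegral_FTC2 (F := fun x => - 3^-1 * cos x ^+ 3)).
- exact: pi_gt0.
- by continuous_trig.
- move=> x; have := is_deriveZ (- 3^-1) (is_deriveX 3 (is_derive_cos x)).
  by move/is_derive_eq; apply; rewrite /GRing.scale /=; field.
- by rewrite cospi cos0; field.
Qed.

Lemma polar_sin3 :
  has_Rintegral mu `[0, pi] (fun x => sin x * sin x * sin x) (4 / 3).
Proof.
(* Since [sin^3 = sin - cos^2 sin], the two preceding integrals suffice. *)
have -> : 4 / 3 = 2 - 2 / 3 :> R by field.
apply: eq_has_Rintegral (has_RintegralB polar_sin polar_cos2sin) => // x.
by rewrite -!expr2 sin2cos2; ring.
Qed.

Lemma polar_sin2cos :
  has_Rintegral mu `[0, pi] (fun x => sin x * sin x * cos x) 0.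
Proof.
apply: (has_Rintegral_FTC2 (F := fun x => 3^-1 * sin x ^+ 3)).
- exact: pi_gt0.
- by continuous_trig.
- move=> x; have := is_deriveZ (3^-1) (is_deriveX 3 (is_derive_sin x)).
  by move/is_derive_eq; apply; rewrite /GRing.scale /=; field.
- by rewrite sinpi sin0; field.
Qed.

Let twopi_gt0 : 0 < 2 * pi :> R. Proof. by rewrite mulr_gt0// pi_gt0. Qed.
Let sin_twopi : sin (2 * pi) = 0 :> R. Proof. by rewrite mulr_natl sin2pi. Qed.
Let cos_twopi : cos (2 * pi) = 1 :> R. Proof. by rewrite mulr_natl cos2pi. Qed.

Lemma azimuth_1 : has_Rintegral mu `[0, 2 * pi] (fun=> 1) (2 * pi).
Proof.
apply: (has_Rintegral_FTC2 (F := id)) => //.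
- by move=> x; exact: cvg_cst.
- by rewrite subr0.
Qed.

Lemma azimuth_cos : has_Rintegral mu `[0, 2 * pi] cos 0.
Proof.
apply: (has_Rintegral_FTC2 (F := sin)) => //.
- exact: continuous_cos.
- by rewrite sin_twopi sin0 subrr.
Qed.

Lemma azimuth_sin : has_Rintegral mu `[0, 2 * pi] sin 0.
Proof.
apply: (has_Rintegral_FTC2 (F := fun x => - cos x)) => //.
- exact: continuous_sin.
- by move=> x; have := is_deriveN (is_derive_cos x); rewrite opprK.
- by rewrite cos_twopi cos0; ring.
Qed.

Lemma azimuth_cossin :
  has_Rintegral mu `[0, 2 * pi] (fun x => cos x * sin x) 0.
Proof.
apply: (has_Rintegral_FTC2 (F := fun x => 2^-1 * sin x ^+ 2)) => //.
- by continuous_trig.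
- move=> x; have := is_deriveZ (2^-1) (is_deriveX 2 (is_derive_sin x)).
  by move/is_derive_eq; apply; rewrite /GRing.scale /=; field.
- by rewrite sin_twopi sin0; field.
Qed.

Lemma azimuth_cos2 :
  has_Rintegral mu `[0, 2 * pi] (fun x => cos x * cos x) pi.
Proof.
apply: (has_Rintegral_FTC2 (F := fun x => 2^-1 * (x + sin x * cos x))) => //.
- by continuous_trig.
- move=> x; have := is_deriveZ (2^-1)
    (is_deriveD (is_derive_id x 1)
       (is_deriveM (is_derive_sin x) (is_derive_cos x))).
  move/is_derive_eq; apply; rewrite /GRing.scale /=.
  by rewrite mulrN -[sin x * sin x]expr2 sin2cos2; field.
- by rewrite sin_twopi sin0; field.
Qed.

Lemma azimuth_sin2 :
  has_Rintegral mu `[0, 2 * pi] (fun x => sin x * sin x) pi.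
Proof.
have -> : has_Rintegral mu `[0, 2 * pi] (fun x => sin x * sin x) pi =
    has_Rintegral mu `[0, 2 * pi] (fun x => sin x * sin x) (2 * pi - pi).
  by congr has_Rintegral; ring.
apply: eq_has_Rintegral (has_RintegralB azimuth_1 azimuth_cos2) => // x.
by rewrite -!expr2 sin2cos2.
Qed.

Lemma sphere_area :
  has_Rintegral lebesgue2 (@sphere_dom R) sphere_jac (4 * pi).
Proof.
have -> : 4 * pi = 2 * (2 * pi) :> R by ring.
apply: eq_has_Rintegral (has_Rintegral_prod polar_sin azimuth_1) => // x.
by rewrite mulr1.
Qed.

(** Numbering the coordinates turns dot products into finite sums. The default value of [nth] is
    never reached, since the index is below 3. *)
Definition coord3 (i : 'I_3) (v : R3 R) : R := nth 0 [:: v.1.1; v.1.2; v.2] i.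

(** Isotropy of the sphere: the matrix of second moments is a multiple of the identity, with trace
    the area [4 * pi]. Every entry splits into a polar and an azimuthal integral, and symmetry
    leaves six of them. *)
Lemma sphere_second_moment (i j : 'I_3) :
  has_Rintegral lebesgue2 (@sphere_dom R)
    (fun a => coord3 i (sphere_pt a) * coord3 j (sphere_pt a) * sphere_jac a)
    (if i == j then 4 / 3 * pi else 0).
Proof.
wlog ij : i j / (i <= j)%N.
  move=> H; have [/H//|/ltnW/H] := leqP i j; rewrite eq_sym.
  by apply: eq_has_Rintegral => a; rewrite [coord3 j _ * _]mulrC.
have H (F G : R -> R) I J K : K = I * J ->
    has_Rintegral mu `[0, pi] F I -> has_Rintegral mu `[0, 2 * pi] G J ->
    has_Rintegral lebesgue2 (@sphere_dom R) (fun a => F a.1 * G a.2) K.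
  by move=> -> HF HG; exact: (has_Rintegral_prod HF HG).
case: i j ij => [[|[|[|//]]] ?] [[|[|[|//]]] ?] //= _;
  rewrite /eq_op /= /coord3 /sphere_jac /=.
- apply: eq_has_Rintegral (H _ _ _ _ _ _ polar_sin3 azimuth_cos2) => [a|];
    rewrite /=; ring.
- apply: eq_has_Rintegral (H _ _ _ _ _ _ polar_sin3 azimuth_cossin) => [a|];
    rewrite /=; ring.
- apply: eq_has_Rintegral (H _ _ _ _ _ _ polar_sin2cos azimuth_cos) => [a|];
    rewrite /=; ring.
- apply: eq_has_Rintegral (H _ _ _ _ _ _ polar_sin3 azimuth_sin2) => [a|];
    rewrite /=; ring.
- apply: eq_has_Rintegral (H _ _ _ _ _ _ polar_sin2cos azimuth_sin) => [a|];
    rewrite /=; ring.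
- by apply: eq_has_Rintegral (H _ _ _ _ _ _ polar_cos2sin azimuth_1) => [a|];
    rewrite /=; field.
Qed.

End SphereIntegrals.

(** * Admissible test functions and their derivatives *)

Section TestFunctions.
Context {R : realType}.
Implicit Types (u v h : R3 R) (F G : R3 R -> R) (d : R).

(* |(v, d)| in R^4: a smooth approximation of |v|. *)
Definition regnorm3 d v : R := Num.sqrt (d ^+ 2 + sqnorm3 v).

Lemma sqnorm3_ge0 v : 0 <= sqnorm3 v.
Proof. by rewrite /sqnorm3 /dot3 -!expr2 !addr_ge0// sqr_ge0. Qed.

Lemma regnorm3_arg_gt0 d v : 0 < d -> 0 < d ^+ 2 + sqnorm3 v.
Proof. by move=> d0; rewrite ltr_pwDl ?sqnorm3_ge0// exprn_gt0. Qed.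

Lemma regnorm3_gt0 d v : 0 < d -> 0 < regnorm3 d v.
Proof. by move=> d0; rewrite sqrtr_gt0 regnorm3_arg_gt0. Qed.

Lemma sqr_regnorm3 d v : 0 < d -> regnorm3 d v ^+ 2 = d ^+ 2 + sqnorm3 v.
Proof. by move=> d0; rewrite sqr_sqrtr// ltW// regnorm3_arg_gt0. Qed.

(** A syntactic class of differentiable functions that is stable under directional derivatives, so
    that smoothness of all orders follows by induction. The inverse of [regnorm3 d] is a generator
    because it appears in the derivative of [regnorm3 d]. *)
Inductive regular_fun d : (R3 R -> R) -> Prop :=
| regular_cst c : regular_fun d (fun=> c)
| regular_coord i : regular_fun d (coord3 i)
| regular_regnorm3 : regular_fun d (regnorm3 d)
| regular_regnorm3V : regular_fun d (fun v => (regnorm3 d v)^-1)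
| regularD F G : regular_fun d F -> regular_fun d G ->
    regular_fun d (fun v => F v + G v)
| regularM F G : regular_fun d F -> regular_fun d G ->
    regular_fun d (fun v => F v * G v).

Lemma coord3_is_linear i : linear (coord3 i : R3 R -> R).
Proof. by case: i => [[|[|[|//]]] ?] k u v. Qed.

HB.instance Definition _ (i : 'I_3) :=
  GRing.isLinear.Build R (R3 R) R _ (coord3 i) (coord3_is_linear i).

Lemma continuous_coord3 i : continuous (coord3 i : R3 R -> R).
Proof.
case: i => [[|[|[|//]]] ?] v; rewrite /coord3 /=.
- exact: (cvg_comp _ _ cvg_fst cvg_fst).
- exact: (cvg_comp _ _ cvg_fst cvg_snd).
- exact: cvg_snd.
Qed.

Lemma differentiable_coord3 i v : differentiable (coord3 i : R3 R -> R) v.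
Proof. exact/linear_differentiable/continuous_coord3. Qed.

Lemma derive_coord3 i v h : 'D_h (coord3 i) v = coord3 i h.
Proof.
rewrite deriveE; last exact: differentiable_coord3.
by rewrite diff_lin//; exact: continuous_coord3.
Qed.

Lemma sqnorm3E v : sqnorm3 v = \sum_(i < 3) coord3 i v * coord3 i v.
Proof. by rewrite !big_ord_recr big_ord0 /= add0r. Qed.

Lemma dot3E u v : dot3 u v = \sum_(i < 3) coord3 i u * coord3 i v.
Proof. by rewrite !big_ord_recr big_ord0 /= add0r. Qed.

Lemma regular_sqnorm3 d : regular_fun d (@sqnorm3 R).
Proof.
have -> : @sqnorm3 R = fun v => coord3 ord0 v * coord3 ord0 v +
    coord3 1 v * coord3 1 v + coord3 2 v * coord3 2 v by [].
by do !constructor.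
Qed.

Lemma regularZ d k F : regular_fun d F -> regular_fun d (fun v => k * F v).
Proof. by move=> rF; apply: regularM => //; exact: regular_cst. Qed.

Lemma regular_dot3 d h : regular_fun d (dot3 h).
Proof.
have -> : dot3 h = fun v => coord3 ord0 h * coord3 ord0 v +
    coord3 1 h * coord3 1 v + coord3 2 h * coord3 2 v by [].
by do !constructor.
Qed.

Lemma differentiable_regular d F v :
  0 < d -> regular_fun d F -> differentiable F v.
Proof.
move=> d0.
have dnorm u : differentiable (regnorm3 d) u.
  rewrite /regnorm3.
  apply: (@differentiable_comp _ _ _ _ (fun v => d ^+ 2 + sqnorm3 v) Num.sqrt).
    have -> : (fun v => d ^+ 2 + sqnorm3 v) =
        cst (d ^+ 2) + (coord3 ord0 * coord3 ord0 + coord3 1 * coord3 1 +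
        coord3 2 * coord3 2) :> (R3 R -> R) by [].
    by do ![apply: differentiableD|apply: differentiableM|
            exact: differentiable_coord3|exact: differentiable_cst].
  apply/derivable1_diffP.
  (* The positivity of [d] keeps the argument away from 0, where the square root is not
     differentiable. *)
  by case: (is_derive1_sqrt (regnorm3_arg_gt0 u d0)).
elim=> {F} [c|i| | |F G _ dF _ dG|F G _ dF _ dG].
- exact: differentiable_cst.
- exact: differentiable_coord3.
- exact: dnorm.
- by apply: differentiableV => //; rewrite gt_eqF// regnorm3_gt0.
- exact: differentiableD.
- exact: differentiableM.
Qed.

Lemma is_derive_sqnorm3 v h : is_derive v h (@sqnorm3 R) (2 * dot3 h v).
Proof.
have c i : is_derive v h (coord3 i) (coord3 i h).
  rewrite -(derive_coord3 i v h).
  exact/derivableP/diff_derivable/differentiable_coord3.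
have cc i := is_deriveM (c i) (c i).
have := is_deriveD (is_deriveD (cc ord0) (cc 1)) (cc 2).
by move/is_derive_eq; apply; rewrite /GRing.scale /= /dot3 /coord3 /=; ring.
Qed.

(** Both sides of [regnorm3 d v ^+ 2 = d ^+ 2 + sqnorm3 v] are differentiated, and the result is
    divided by the positive number [2 * regnorm3 d v]. *)
Lemma derive_regnorm3 d v h : 0 < d ->
  'D_h (regnorm3 d) v = dot3 h v * (regnorm3 d v)^-1.
Proof.
move=> d0; have w0 := regnorm3_gt0 v d0.
have dw : derivable (regnorm3 d) v h.
  exact/diff_derivable/(differentiable_regular _ d0)/regular_regnorm3.
have E : regnorm3 d * regnorm3 d = cst (d ^+ 2) + @sqnorm3 R.
  by apply/funext => u; rewrite !fctE -expr2 sqr_regnorm3.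
have d1 := is_deriveM (derivableP dw) (derivableP dw).
have d2 := is_deriveD (is_derive_cst (d ^+ 2) v h) (is_derive_sqnorm3 v h).
rewrite E in d1; have := etrans (esym (@derive_val _ _ _ _ _ _ _ d1))
  (@derive_val _ _ _ _ _ _ _ d2).
rewrite /GRing.scale /= => EE.
by apply: (mulfI (lt0r_neq0 w0)); rewrite [RHS]mulrCA divff ?lt0r_neq0//; lra.
Qed.

Lemma derive_regular d F h : 0 < d -> regular_fun d F ->
  regular_fun d (fun v => 'D_h F v).
Proof.
move=> d0.
have rnorm : regular_fun d (fun v => 'D_h (regnorm3 d) v).
  under eq_fun do rewrite derive_regnorm3//.
  apply: regularM; [exact: regular_dot3|exact: regular_regnorm3V].
have dr G v : regular_fun d G -> derivable G v h.
  by move=> rG; exact/diff_derivable/(differentiable_regular _ d0).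
elim=> {F} [c|i| | |F G rF dF rG dG|F G rF dF rG dG].
- under eq_fun do rewrite derive_cst; exact: regular_cst.
- under eq_fun do rewrite derive_coord3; exact: regular_cst.
- exact: rnorm.
(* The derivative of the inverse is written as a product of members of the class, the sign being a
   constant factor. *)
- have -> : (fun v => 'D_h (fun v => (regnorm3 d v)^-1) v) = fun v =>
      - 1 * ((regnorm3 d v)^-1 * (regnorm3 d v)^-1 * 'D_h (regnorm3 d) v).
    apply/funext => v; rewrite deriveV; last 2 first.
      + by rewrite gt_eqF// regnorm3_gt0.
      + exact/dr/regular_regnorm3.
    by rewrite /GRing.scale /= -exprVn expr2 mulN1r mulNr.
  by apply: regularZ; do !apply: regularM => //; exact: regular_regnorm3V.
- have -> : (fun v => 'D_h (fun v => F v + G v) v) = fun v => 'D_h F v + 'D_h G v.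
    by apply/funext => v; rewrite -deriveD//; exact: dr.
  exact: regularD.
- have -> : (fun v => 'D_h (fun v => F v * G v) v) =
      fun v => F v * 'D_h G v + G v * 'D_h F v.
    by apply/funext => v; rewrite (deriveM (dr _ v rF) (dr _ v rG)).
  by apply: regularD; exact: regularM.
Qed.

Lemma smooth_regular d F : 0 < d -> regular_fun d F -> smooth F.
Proof.
move=> d0 + k; elim: k F => [|k IH] F rF /=.
  by move=> v; exact/differentiable_continuous/(differentiable_regular _ d0).
split.
- by move=> v; exact/differentiable_continuous/(differentiable_regular _ d0).
- by move=> v h; exact/diff_derivable/(differentiable_regular _ d0).
- by move=> h; apply: IH; exact: derive_regular.
Qed.

Lemma test_cst (c : R) : test_function (fun _ : R3 R => c).
Proof.
(* [ltr01] sets the parameter of the class to 1; any positive value is admissible here. *)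
split; first exact: (smooth_regular ltr01 (regular_cst _ _)).
by exists `|c| => v; rewrite ler_peMr// lerDl sqnorm3_ge0.
Qed.

Lemma ler_sqr_coord3 i v : coord3 i v ^+ 2 <= sqnorm3 v.
Proof.
rewrite sqnorm3E (bigD1 i)//= -expr2 lerDl sumr_ge0// => j _.
by rewrite -expr2 sqr_ge0.
Qed.

Lemma test_coord3 i : test_function (coord3 i : R3 R -> R).
Proof.
split; first exact: (smooth_regular ltr01 (regular_coord _ _)).
exists 1 => v; rewrite mul1r.
have := ler_sqr_coord3 i v; rewrite -real_normK ?num_real// => H.
by have := sqr_ge0 (`|coord3 i v| - 1); nra.
Qed.

Lemma test_sqnorm3 : test_function (@sqnorm3 R).
Proof.
split; first exact: (smooth_regular ltr01 (regular_sqnorm3 _)).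
by exists 1 => v; rewrite mul1r ger0_norm ?sqnorm3_ge0// lerDr.
Qed.

Lemma test_regnorm3 d : 0 < d -> test_function (regnorm3 d).
Proof.
move=> d0; split; first exact: (smooth_regular d0 (regular_regnorm3 _)).
(* With [w = regnorm3 d v], one has [2 w <= 1 + w^2 = 1 + d^2 + |v|^2], which is at most
   [(1 + d^2) (1 + |v|^2)]. *)
exists (1 + d ^+ 2) => v; rewrite ger0_norm ?sqrtr_ge0//.
have := sqr_regnorm3 v d0; have := sqnorm3_ge0 v.
have := sqr_ge0 (regnorm3 d v - 1); have := sqr_ge0 d; nra.
Qed.

End TestFunctions.

(** * Pointwise identities and inequalities for a single collision *)

Section CollisionAlgebra.
Context {R : realType}.
Implicit Types (u v w n p q : R3 R) (d e s x : R).

Lemma sqnorm3_sphere_pt (a : R * R) : sqnorm3 (sphere_pt a) = 1.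
Proof.
rewrite /sqnorm3 /dot3 /=; have := cos2Dsin2 a.1; have := cos2Dsin2 a.2.
set x := cos a.2; set y := sin a.2; set z := cos a.1; set t := sin a.1.
move=> xy <-; rewrite -[t ^+ 2]mulr1 -xy; ring.
Qed.

Lemma sphere_jac_ge0 (a : R * R) : sphere_dom a -> 0 <= sphere_jac a.
Proof. by move=> [/= a1 _]; exact: sin_ge0_pi. Qed.

(** With [u = v - w] and [b = (1 + e) / 2 * (u . n)], the energy changes by [2 b (b - u . n)], and
    [b - u . n = - (1 - e) / 2 * (u . n)]. *)
Lemma post_energy e v w n : sqnorm3 n = 1 ->
  sqnorm3 (post1 e v w n) + sqnorm3 (post2 e v w n) - sqnorm3 v - sqnorm3 w =
  - ((1 - e ^+ 2) / 2 * dot3 (v - w) n ^+ 2).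
Proof.
move=> n1; set b := (1 + e) / 2 * dot3 (v - w) n.
have -> : sqnorm3 (post1 e v w n) + sqnorm3 (post2 e v w n) - sqnorm3 v -
    sqnorm3 w = - (2 * b * dot3 (v - w) n) + 2 * b ^+ 2 * sqnorm3 n.
  by rewrite /post1 /post2 -/b /sqnorm3 /dot3 /= /GRing.scale /=; ring.
by rewrite n1 /b; field.
Qed.

Lemma post_coord3 i e v w n :
  coord3 i (post1 e v w n) + coord3 i (post2 e v w n) = coord3 i v + coord3 i w.
Proof.
rewrite /post1 /post2 (linearB (@coord3 R i)) (linearD (@coord3 R i)).
by rewrite addrACA addNr addr0.
Qed.

(** Lagrange's identity: the defect is the squared length of the cross product. *)
Lemma cauchy_dot3 p q : dot3 p q ^+ 2 <= sqnorm3 p * sqnorm3 q.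
Proof.
rewrite -subr_ge0; have -> : sqnorm3 p * sqnorm3 q - dot3 p q ^+ 2 =
    (p.1.1 * q.1.2 - p.1.2 * q.1.1) ^+ 2 + (p.1.1 * q.2 - p.2 * q.1.1) ^+ 2 +
    (p.1.2 * q.2 - p.2 * q.1.2) ^+ 2.
  by rewrite /sqnorm3 /dot3; ring.
by rewrite !addr_ge0// sqr_ge0.
Qed.

(** The Cauchy-Schwarz inequality in R^4 for [(p, d)] and [(q, d)]. The defect of the squares is
    [d^2 |p - q|^2] plus the defect in R^3. *)
Lemma cauchy_regnorm3 d p q : 0 < d ->
  `|d ^+ 2 + dot3 p q| <= regnorm3 d p * regnorm3 d q.
Proof.
move=> d0; have p0 := regnorm3_gt0 p d0; have q0 := regnorm3_gt0 q d0.
rewrite -ler_sqr ?nnegrE ?mulr_ge0 ?(ltW p0) ?(ltW q0)//.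
rewrite real_normK ?num_real// exprMn !sqr_regnorm3//.
have h2 := cauchy_dot3 p q; have := mulr_ge0 (sqr_ge0 d) (sqnorm3_ge0 (p - q)).
have -> : sqnorm3 (p - q) = sqnorm3 p + sqnorm3 q - 2 * dot3 p q.
  by rewrite /sqnorm3 /dot3 /=; ring.
rewrite -subr_ge0 in h2 => h1. rewrite -subr_ge0.
have -> : (d ^+ 2 + sqnorm3 p) * (d ^+ 2 + sqnorm3 q) - (d ^+ 2 + dot3 p q) ^+ 2 =
    d ^+ 2 * (sqnorm3 p + sqnorm3 q - 2 * dot3 p q) +
    (sqnorm3 p * sqnorm3 q - dot3 p q ^+ 2) by ring.
by rewrite addr_ge0.
Qed.

(* In R^4 this is | |P| - |Q| | <= |P + Q| <= |P'| + |Q'| with P = (v, d),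
   Q = (w, d), which holds because P + Q = P' + Q' is conserved. *)
Lemma post_regnorm3 d e v w n : 0 < d ->
  `|regnorm3 d v - regnorm3 d w| <=
  regnorm3 d (post1 e v w n) + regnorm3 d (post2 e v w n).
Proof.
move=> d0; set p := post1 e v w n; set q := post2 e v w n.
have p0 := regnorm3_gt0 p d0; have q0 := regnorm3_gt0 q d0.
rewrite -ler_sqr ?nnegrE ?addr_ge0 ?(ltW p0) ?(ltW q0)// real_normK ?num_real//.
have := cauchy_regnorm3 v w d0; have := cauchy_regnorm3 p q d0.
(* After squaring, the inner product is bounded below by Cauchy-Schwarz before the collision and
   above after it; conservation of momentum links the two. *)
rewrite !ler_norml => /andP[_ pq] /andP[vw _].
rewrite sqrrB sqrrD !sqr_regnorm3//.
have : sqnorm3 v + sqnorm3 w + 2 * dot3 v w = sqnorm3 p + sqnorm3 q + 2 * dot3 p q.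
  by rewrite /p /q /post1 /post2 /sqnorm3 /dot3 /= /GRing.scale /=; ring.
lra.
Qed.

(** Cauchy-Schwarz bounds the left side by [|v - w|], and [(v - w, 0)] is the difference of [(v, d)]
    and [(w, d)], to which the triangle inequality in R^4 applies. *)
Lemma ler_norm_relative d v w n : 0 < d -> sqnorm3 n = 1 ->
  `|dot3 (v - w) n| <= regnorm3 d v + regnorm3 d w.
Proof.
move=> d0 n1; have v0 := regnorm3_gt0 v d0; have w0 := regnorm3_gt0 w d0.
rewrite -ler_sqr ?nnegrE ?addr_ge0 ?(ltW v0) ?(ltW w0)// real_normK ?num_real//.
apply: le_trans (cauchy_dot3 _ _) _; rewrite n1 mulr1.
rewrite sqrrD !sqr_regnorm3//.
have -> : sqnorm3 (v - w) = sqnorm3 v + sqnorm3 w - 2 * dot3 v w.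
  by rewrite /sqnorm3 /dot3 /=; ring.
have := cauchy_regnorm3 v w d0; rewrite ler_norml => /andP[vw _].
have := sqr_ge0 d; lra.
Qed.

(** Let [a] and [b] be the regularised norms of [v] and [w]. The bracket is at least
    [|a - b| - a - b = - 2 min(a, b)], while [|u . n| <= a + b <= 2 max(a, b)]; the product of the
    minimum and the maximum is [a b]. *)
Lemma collision_regnorm3_ge d e v w n : 0 < d -> sqnorm3 n = 1 ->
  - (4 * (regnorm3 d v * regnorm3 d w)) <=
  `|dot3 (v - w) n| * (regnorm3 d (post1 e v w n) +
    regnorm3 d (post2 e v w n) - regnorm3 d v - regnorm3 d w).
Proof.
move=> d0 n1; have := post_regnorm3 e v w n d0; have := ler_norm_relative v w d0 n1.
have := regnorm3_gt0 v d0; have := regnorm3_gt0 w d0.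
move: (normr_ge0 (dot3 (v - w) n)).
set a := regnorm3 d v; set b := regnorm3 d w; set x := `|dot3 _ _|.
set y := _ + regnorm3 _ _ => x0 b0 a0 xab; rewrite ler_norml => /andP[h1 h2].
have [ab|ba] := leP a b; nra.
Qed.

(** As a function of [y = x^2] the cube is the convex function [y^(3/2)], and the left side is its
    tangent at [y = s^2]. Being linear in [x^2], it has an integral that second moments
    determine. *)
Lemma cube_ge_tangent x s : 0 <= x -> 0 <= s ->
  (3 * s * x ^+ 2 - s ^+ 3) / 2 <= x ^+ 3.
Proof.
move=> x0 s0; have : 0 <= (x - s) ^+ 2 * (2 * x + s).
  by rewrite mulr_ge0 ?sqr_ge0// addr_ge0// mulr_ge0.
have -> : (x - s) ^+ 2 * (2 * x + s) = 2 * x ^+ 3 + s ^+ 3 - 3 * s * x ^+ 2.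
  by ring.
lra.
Qed.

End CollisionAlgebra.

(** * Moments of a density and their collision integrals *)

Section Moments.
Context {R : realType} (e : R) (g : R3 R -> R).
Hypothesis g_ge0 : forall v, 0 <= g v.
Hypothesis g_int : lebesgue3.-integrable setT (EFin \o g).
Hypothesis g_energy : (energy g < +oo)%E.
Implicit Types (h psi : R3 R -> R) (d s : R).

Lemma measurable_coord3 i : measurable_fun setT (@coord3 R i).
Proof.
case: i => [[|[|[|//]]] ?]; rewrite /coord3 /=.
- exact: (measurableT_comp measurable_fst measurable_fst).
- exact: (measurableT_comp measurable_snd measurable_fst).
- exact: measurable_snd.
Qed.

Lemma measurable_sqnorm3 : measurable_fun setT (@sqnorm3 R).
Proof.
have m i := measurable_funM (measurable_coord3 i) (measurable_coord3 i).
exact: (measurable_funD (measurable_funD (m ord0) (m 1)) (m 2)).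
Qed.

Lemma measurable_regnorm3 d : measurable_fun setT (@regnorm3 R d).
Proof.
apply: (measurableT_comp (continuous_measurable_fun (@sqrt_continuous R))).
by apply: measurable_funD => //; exact: measurable_sqnorm3.
Qed.

Let g_meas : measurable_fun setT g.
Proof. by apply/measurable_EFinP; case/integrableP: g_int. Qed.

Lemma integrable_energy :
  lebesgue3.-integrable setT (EFin \o (fun v => g v * sqnorm3 v)).
Proof.
apply/integrableP; split.
  by apply/measurable_EFinP/measurable_funM => //; exact: measurable_sqnorm3.
apply: le_lt_trans g_energy; rewrite le_eqVlt; apply/orP; left; apply/eqP.
by apply: eq_integral => v _ /=; rewrite ger0_norm// mulr_ge0// sqnorm3_ge0.
Qed.

(** Finite mass and energy supply the dominating function [C * (g v + g v * sqnorm3 v)]. *)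
Lemma integrable_moment h C : measurable_fun setT h ->
  (forall v, `|h v| <= C * (1 + sqnorm3 v)) ->
  lebesgue3.-integrable setT (EFin \o (fun v => g v * h v)).
Proof.
move=> mh hC.
have := integrableZl measurableT C
  (integrableD measurableT g_int integrable_energy).
apply: le_integrable => //; first exact/measurable_EFinP/measurable_funM.
move=> v _ /=; rewrite lee_fin normrM (ger0_norm (g_ge0 v)).
apply: le_trans (ler_wpM2l (g_ge0 v) (hC v)) _.
have -> : g v * (C * (1 + sqnorm3 v)) = C * (g v + g v * sqnorm3 v) by ring.
exact: ler_norm.
Qed.

Definition moment psi := \int[lebesgue3]_v (g v * psi v).

Lemma has_moment h C : measurable_fun setT h ->
  (forall v, `|h v| <= C * (1 + sqnorm3 v)) ->
  has_Rintegral lebesgue3 setT (fun v => g v * h v) (moment h).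
Proof. by move=> mh hC; split=> //; exact: integrable_moment hC. Qed.

Lemma has_moment_cst c :
  has_Rintegral lebesgue3 setT (fun v => g v * c) (moment (fun=> c)).
Proof.
have [_ [C hC]] := test_cst c; apply: has_moment hC; exact: measurable_cst.
Qed.

Lemma has_moment_coord3 i :
  has_Rintegral lebesgue3 setT (fun v => g v * coord3 i v) (moment (coord3 i)).
Proof.
have [_ [C hC]] := @test_coord3 R i; apply: has_moment hC.
exact: measurable_coord3.
Qed.

Lemma has_moment_coord3M i j :
  has_Rintegral lebesgue3 setT (fun v => g v * (coord3 i v * coord3 j v))
    (moment (fun v => coord3 i v * coord3 j v)).
Proof.
apply: (has_moment (C := 1)).
  by apply: measurable_funM; exact: measurable_coord3.
move=> v; have := ler_sqr_coord3 i v; have := ler_sqr_coord3 j v.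
rewrite ler_norml => hj hi; have := sqr_ge0 (coord3 i v + coord3 j v).
have := sqr_ge0 (coord3 i v - coord3 j v); rewrite sqrrB sqrrD => h1 h2.
apply/andP; split; lra.
Qed.

Lemma has_moment_sqnorm3 :
  has_Rintegral lebesgue3 setT (fun v => g v * sqnorm3 v) (moment (@sqnorm3 R)).
Proof. by split=> //; exact: integrable_energy. Qed.

Lemma has_moment_regnorm3 d : 0 < d ->
  has_Rintegral lebesgue3 setT (fun v => g v * regnorm3 d v)
    (moment (regnorm3 d)).
Proof.
move=> d0; have [_ [C hC]] := test_regnorm3 d0; apply: has_moment hC.
exact: measurable_regnorm3.
Qed.

Lemma energyE : energy g = (moment (@sqnorm3 R))%:E.
Proof.
rewrite /moment /Rintegral fineK//.
exact: (integrable_fin_num _ integrable_energy).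
Qed.

Lemma moment_sqnorm3 :
  moment (@sqnorm3 R) = \sum_(i < 3) moment (fun v => coord3 i v * coord3 i v).
Proof.
have [_ _ <-] := has_Rintegral_sum (index_enum 'I_3) measurableT
  (fun i => has_moment_coord3M i i).
by apply: eq_Rintegral => v _; rewrite sqnorm3E mulr_sumr.
Qed.

Let set0E3 : [set (0 : R3 R)] = ([set 0] `*` [set 0]) `*` [set 0].
Proof. by apply/seteqP; split=> [_ -> //|[[x y] z] [[/= -> ->] ->]]. Qed.

Lemma lebesgue3_set0 : lebesgue3 [set (0 : R3 R)] = 0%E.
Proof.
rewrite set0E3 /lebesgue3 product_measure1E//; last exact: measurableX.
rewrite [X in (_ * X)%E](_ : _ = 0%E) ?mule0//; exact: lebesgue_measure_set1.
Qed.

Lemma regnorm3_homo d v : regnorm3 0 v <= regnorm3 d v.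
Proof. by rewrite ler_wsqrtr// lerD2r expr0n sqr_ge0. Qed.

(** [regnorm3 0] is the Euclidean norm itself. It is not smooth at the origin, so its growth bound
    is borrowed from [regnorm3 1], which dominates it. *)
Lemma has_moment_norm :
  has_Rintegral lebesgue3 setT (fun v => g v * regnorm3 0 v)
    (moment (regnorm3 0)).
Proof.
have [_ [C hC]] := test_regnorm3 (@ltr01 R).
apply: (has_moment (C := C)) => [|v]; first exact: measurable_regnorm3.
apply: le_trans (hC v).
by rewrite !ger0_norm ?sqrtr_ge0// regnorm3_homo.
Qed.

Lemma moment_norm_le d : 0 < d -> moment (regnorm3 0) <= moment (regnorm3 d).
Proof.
move=> d0; apply: (le_has_Rintegral has_moment_norm (has_moment_regnorm3 d0)).
by move=> v _; rewrite ler_wpM2l// regnorm3_homo.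
Qed.

Lemma has_collision_prod (G : R3 R * R3 R -> R) (H : R * R -> R) I J :
  has_Rintegral lebesgue33 setT G I ->
  has_Rintegral lebesgue2 sphere_dom H J ->
  has_Rintegral collision_measure collision_dom (fun z => G z.1 * H z.2) (I * J).
Proof.
by move=> hG hH; exact: has_Rintegral_prod hG hH.
Qed.

Lemma has_pair_moment h1 h2 I J :
  has_Rintegral lebesgue3 setT (fun v => g v * h1 v) I ->
  has_Rintegral lebesgue3 setT (fun v => g v * h2 v) J ->
  has_Rintegral lebesgue33 setT
    (fun z => g z.1 * g z.2 * (h1 z.1 * h2 z.2)) (I * J).
Proof.
move=> h1I h2J; rewrite -setXTT.
apply: eq_has_Rintegral (has_Rintegral_prod h1I h2J).
by move=> z; rewrite mulrACA.
Qed.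

Hypothesis g_mass : moment (fun=> 1) = 1.

Lemma has_pair_moment_collision d : 0 < d ->
  has_Rintegral collision_measure collision_dom
    (fun z => g z.1.1 * g z.1.2 * (regnorm3 d z.1.1 * regnorm3 d z.1.2) *
       sphere_jac z.2)
    (moment (regnorm3 d) * moment (regnorm3 d) * (4 * pi)).
Proof.
move=> d0; have hw := has_moment_regnorm3 d0.
exact: (has_collision_prod (has_pair_moment hw hw) (@sphere_area R)).
Qed.

Lemma has_pair_mass_collision :
  has_Rintegral collision_measure collision_dom
    (fun z => g z.1.1 * g z.1.2 * sphere_jac z.2) (4 * pi).
Proof.
have h1 := has_moment_cst 1; rewrite g_mass in h1.
have -> : 4 * pi = 1 * 1 * (4 * pi) :> R by rewrite !mul1r.
apply: eq_has_Rintegral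
  (has_collision_prod (has_pair_moment h1 h1) (@sphere_area R)).
by move=> z; rewrite !mulr1.
Qed.

(** If the first moment were zero, [g] would vanish almost everywhere off the origin, which is a
    null set, and the mass could not be 1. *)
Lemma moment_norm_gt0 : 0 < moment (regnorm3 0).
Proof.
pose h v := g v * regnorm3 0 v.
have h_ge0 v : 0 <= h v by rewrite mulr_ge0// sqrtr_ge0.
rewrite lt_neqAle; apply/andP; split; last first.
  by apply: Rintegral_ge0 => v _; exact: h_ge0.
apply/eqP => M0; have [_ ih _] := has_moment_norm; rewrite -/h in ih.
have mh : measurable_fun setT (EFin \o h) by case/integrableP: ih.
have [h_ae0 _] := ae_eq_integral_abs lebesgue3 measurableT mh.
have [|N [mN N0 sub]] := h_ae0.
  rewrite (_ : 0%E = (moment (regnorm3 0))%:E); last by rewrite -M0.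
  rewrite /moment /Rintegral fineK; last exact: (integrable_fin_num _ ih).
  by apply: eq_integral => v _; rewrite /= ger0_norm.
have m0 : measurable [set (0 : R3 R)].
  by rewrite set0E3; do !apply: measurableX; exact: measurable_set1.
have mg1 : measurable_fun setT (fun v => (g v * 1)%:E).
  by apply/measurable_EFinP; exact: measurable_funM.
have g0 : (\int[lebesgue3]_v (g v * 1)%:E = 0)%E.
  rewrite -(integral0 lebesgue3 setT); apply: ae_eq_integral => //.
  (* The origin joins the exceptional set, because there [g v * regnorm3 0 v = 0] says nothing about
     [g v]. *)
  exists (N `|` [set 0]); split.
  - exact: measurableU.
  - rewrite measureU0//; exact: lebesgue3_set0.
  move=> v nv; have [->|v0] := pselect (v = 0); [by right|left].
  apply: sub => /= /(_ I) [] /eqP; rewrite mulf_eq0 => /orP[/eqP gv|].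
    by apply: nv => _ /=; rewrite gv mul0r.
  rewrite sqrtr_eq0 expr0n add0r => vle0; apply: v0.
  have c0 i : coord3 i v = 0.
    apply/eqP; rewrite -sqrf_eq0 eq_le sqr_ge0 andbT.
    exact: le_trans (ler_sqr_coord3 i v) vle0.
  by move: (c0 ord0) (c0 1) (c0 2); case: v {nv vle0 c0} => [[x y] z];
    rewrite /coord3 /= => -> -> ->.
by move: g_mass; rewrite /moment /Rintegral g0 => /esym/eqP; rewrite oner_eq0.
Qed.

(** For unit mass, integrating [g v * (M - regnorm3 d v)^2 >= 0] gives [d^2] plus the second moment
    minus [M^2]. *)
Lemma sqr_moment_regnorm3_le d : 0 < d ->
  moment (regnorm3 d) ^+ 2 <= d ^+ 2 + moment (@sqnorm3 R).
Proof.
move=> d0; set M := moment (regnorm3 d).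
have h1 := has_moment_cst 1; rewrite g_mass in h1.
have := le_has_Rintegral (has_RintegralZ (2 * M) (has_moment_regnorm3 d0))
  (has_RintegralD (has_RintegralZ (M ^+ 2 + d ^+ 2) h1) has_moment_sqnorm3).
rewrite -/M => H; suff : 2 * M * M <= (M ^+ 2 + d ^+ 2) * 1 + moment (@sqnorm3 R).
  lra.
apply: H => v _; have := mulr_ge0 (g_ge0 v) (sqr_ge0 (M - regnorm3 d v)).
by rewrite sqrrB sqr_regnorm3//; lra.
Qed.

Hypothesis g_momentum : forall i, moment (coord3 i) = 0.

(** In the expanded product, the two terms with both coordinates on the same velocity each give the
    second moment by unit mass, and the two mixed terms vanish by zero momentum. *)
Lemma has_relative_moment (i j : 'I_3) :
  has_Rintegral lebesgue33 setT
    (fun z => g z.1 * g z.2 * (coord3 i (z.1 - z.2) * coord3 j (z.1 - z.2)))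
    (2 * moment (fun v => coord3 i v * coord3 j v)).
Proof.
have h1 := has_moment_cst 1; rewrite g_mass in h1.
have hi := has_moment_coord3 i; have hj := has_moment_coord3 j.
rewrite !g_momentum in hi hj; have hij := has_moment_coord3M i j.
have := has_RintegralD
  (has_RintegralB (has_pair_moment hij h1) (has_pair_moment hi hj))
  (has_RintegralB (has_pair_moment h1 hij) (has_pair_moment hj hi)).
set M := moment _; rewrite (_ : _ - _ + _ = 2 * M); last by ring.
by apply: eq_has_Rintegral => z; rewrite !linearB /=; ring.
Qed.

(** Expanding [(u . n)^2] into coordinates separates [u] from [n]. Isotropy keeps the diagonal terms
    only, each with factor [2 * (4 / 3 * pi)]. *)
Lemma has_normal_moment_collision :
  has_Rintegral collision_measure collision_dom
    (fun z => g z.1.1 * g z.1.2 * dot3 (z.1.1 - z.1.2) (sphere_pt z.2) ^+ 2 *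
       sphere_jac z.2)
    (8 / 3 * pi * moment (@sqnorm3 R)).
Proof.
have H (i j : 'I_3) :=
  has_collision_prod (has_relative_moment i j) (@sphere_second_moment R i j).
have [md _ _] := H ord0 ord0.
have := has_Rintegral_sum (index_enum 'I_3) md
  (fun i => has_Rintegral_sum (index_enum 'I_3) md (H i)).
have -> : \sum_(i < 3) \sum_(j < 3)
    2 * moment (fun v => coord3 i v * coord3 j v) *
    (if i == j then 4 / 3 * pi else 0) = 8 / 3 * pi * moment (@sqnorm3 R).
  rewrite moment_sqnorm3 mulr_sumr; apply: eq_bigr => i _.
  rewrite (bigD1 i)//= eqxx big1 ?addr0 => [|j ji]; first by field.
  by rewrite eq_sym (negbTE ji) mulr0.
apply: eq_has_Rintegral => z; rewrite dot3E expr2 mulr_suml mulr_sumr mulr_suml.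
apply: eq_bigr => i _; rewrite mulr_sumr mulr_sumr mulr_suml.
by apply: eq_bigr => j _; ring.
Qed.

(** * Bounds on the collision operator tested against energy and regularised norm *)

Hypothesis e01 : 0 < e < 1.

Lemma weakQ_sqnorm3_le s : 0 <= s ->
  collision_measure.-integrable collision_dom
    (EFin \o collision_integrand e g (@sqnorm3 R)) ->
  weakQ e g (@sqnorm3 R) <=
  - ((1 - e ^+ 2) / 2 * (2 * s * moment (@sqnorm3 R) - s ^+ 3)).
Proof.
move=> s0 iQ; have pi0 := @pi_gt0 R.
have k0 : 0 <= (1 - e ^+ 2) / 4.
  by case/andP: e01 => e0 e1; rewrite divr_ge0// subr_ge0 expr_le1// ltW.
(* The factor [(1 - e ^+ 2) / 4] combines [(1 - e ^+ 2) / 2] from [post_energy] with the [1 / 2] of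
   the tangent inequality. *)
have bound := has_RintegralB
  (has_RintegralZ ((1 - e ^+ 2) / 4 * s ^+ 3) has_pair_mass_collision)
  (has_RintegralZ ((1 - e ^+ 2) / 4 * (3 * s)) has_normal_moment_collision).
have hQ : has_Rintegral collision_measure collision_dom
    (collision_integrand e g (@sqnorm3 R))
    (\int[collision_measure]_(z in collision_dom)
       collision_integrand e g (@sqnorm3 R) z).
  by case: bound.
have pi2 : 0 <= (2 * pi)^-1 :> R by rewrite invr_ge0 mulr_ge0// ltW.
rewrite /weakQ.
apply: le_trans (ler_wpM2l pi2 (le_has_Rintegral hQ bound _)) _; last first.
  rewrite le_eqVlt; apply/orP; left; apply/eqP.
  by move: (lt0r_neq0 pi0); generalize (@pi R) => p p0; field.
move=> -[[v w] a] [_ /= /sphere_jac_ge0 j0].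
rewrite /collision_integrand /= post_energy ?sqnorm3_sphere_pt//.
set x := `|dot3 (v - w) (sphere_pt a)|.
have -> : dot3 (v - w) (sphere_pt a) ^+ 2 = x ^+ 2.
  by rewrite real_normK ?num_real.
have := cube_ge_tangent (normr_ge0 _ : 0 <= x) s0; rewrite -subr_ge0 => xs.
have gg : 0 <= g v * g w * sphere_jac a by rewrite !mulr_ge0.
rewrite -subr_ge0; have := mulr_ge0 (mulr_ge0 (ler0n R 2) (mulr_ge0 k0 gg)) xs.
by congr (_ <= _); field.
Qed.

(** The pointwise bound with constant 4 is integrated; the sphere contributes its area [4 * pi], and
    the normalisation [(2 * pi)^-1] leaves [4 * 2 = 8]. *)
Lemma weakQ_regnorm3_ge d : 0 < d ->
  collision_measure.-integrable collision_dom
    (EFin \o collision_integrand e g (regnorm3 d)) ->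
  - (8 * moment (regnorm3 d) ^+ 2) <= weakQ e g (regnorm3 d).
Proof.
move=> d0 iQ; have pi0 := @pi_gt0 R.
have bound := has_RintegralZ (- 4) (has_pair_moment_collision d0).
have hQ : has_Rintegral collision_measure collision_dom
    (collision_integrand e g (regnorm3 d))
    (\int[collision_measure]_(z in collision_dom)
       collision_integrand e g (regnorm3 d) z).
  by case: bound.
have pi2 : 0 <= (2 * pi)^-1 :> R by rewrite invr_ge0 mulr_ge0// ltW.
apply: le_trans (ler_wpM2l pi2 (le_has_Rintegral bound hQ _)).
  rewrite le_eqVlt; apply/orP; left; apply/eqP.
  by move: (lt0r_neq0 pi0); generalize (@pi R) => p p0; field.
move=> -[[v w] a] [_ /= /sphere_jac_ge0 j0]; rewrite /collision_integrand /=.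
have gg : 0 <= g v * g w * sphere_jac a by rewrite !mulr_ge0.
have := ler_wpM2l gg (collision_regnorm3_ge e v w d0 (sqnorm3_sphere_pt a)).
by congr (_ <= _); ring.
Qed.

End Moments.

(** * Differential inequalities on the half-line *)

Section DifferentialInequalities.
Context {R : realType}.
Implicit Types (y m E : R -> R) (k t : R).

(** Right continuity at 0 replaces differentiability there, matching solutions whose equation holds
    only for positive times. *)
Lemma nonincreasing_halfline y : y t @[t --> 0^'+] --> y 0 ->
  (forall t, 0 < t -> exists2 dy, is_derive t 1 y dy & dy <= 0) ->
  forall t, 0 <= t -> y t <= y 0.
Proof.
move=> y0 dy t t0.
have diff (x : R) : x \in `]0, +oo[ -> derivable y x 1.
  by rewrite in_itv/= andbT => /dy[d []].
apply: (@ler0_derive1_nincry _ y 0) => // [x|].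
  rewrite in_itv/= andbT => /dy[d yd d0].
  by rewrite derive1E (@derive_val _ _ _ _ _ _ _ yd).
apply/continuous_within_itvcyP; split=> // x /diff dx.
exact/differentiable_continuous/derivable1_diffP.
Qed.

Lemma constant_halfline y : y t @[t --> 0^'+] --> y 0 ->
  (forall t : R, 0 < t -> is_derive t 1 y 0) ->
  forall t, 0 <= t -> y t = y 0.
Proof.
move=> y0 dy t t0; apply/eqP; rewrite eq_le; apply/andP; split.
  by apply: nonincreasing_halfline t0 => // x /dy; exists 0.
rewrite -lerN2; apply: (@nonincreasing_halfline (- y)) t0 => [|x /dy yx].
  exact: (cvgN y0).
by exists 0 => //; rewrite -oppr0; exact: is_deriveN.
Qed.

(** The derivative of [1 / m] is [- m' / m^2 <= k], so [1 / m - k t] is nonincreasing. *)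
Lemma riccati_lower m k : m t @[t --> 0^'+] --> m 0 ->
  (forall t, 0 <= t -> 0 < m t) ->
  (forall t, 0 < t -> exists2 dm, is_derive t 1 m dm & - (k * m t ^+ 2) <= dm) ->
  forall t, 0 <= t -> (m t)^-1 <= (m 0)^-1 + k * t.
Proof.
move=> cm m0 dm t t0.
suff : (m t)^-1 - k * t <= (m 0)^-1 - k * 0 by rewrite mulr0 subr0 lerBlDr.
apply: (@nonincreasing_halfline (fun s => (m s)^-1 - k * s)) t0 => [|x x0].
  apply: cvgB; first by apply: cvgV => //; rewrite gt_eqF// m0.
  apply: cvgM; first exact: cvg_cst.
  by apply: cvg_at_right_filter; exact: cvg_id.
have [d mx dk] := dm x x0; have mx0 := m0 x (ltW x0).
have md : is_derive x 1 (fun s => (m s)^-1) (- (m x) ^- 2 *: d).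
  have [dmx <-] := mx; split; first by apply: derivableV => //; rewrite gt_eqF.
  by rewrite deriveV// gt_eqF.
have kd := is_deriveZ k (is_derive_id x (1 : R)).
exists (- (m x) ^- 2 *: d - k *: 1); first exact: (is_deriveB md kd).
rewrite /GRing.scale /= mulr1 subr_le0 mulNr lerNl.
by rewrite mulrC ler_pdivlMr ?exprn_gt0// mulNr.
Qed.

(** Optimising over [s] would give a nonlinear inequality with [E^(3/2)]. Letting [s] depend on time
    alone keeps it linear in [E], so that an integrating factor solves it. *)
Lemma cubic_decay_upper E k : 0 < k -> E t @[t --> 0^'+] --> E 0 ->
  (forall t, 0 < t -> exists2 dE, is_derive t 1 E dE &
     forall s, 0 <= s -> dE <= - (k * (2 * s * E t - s ^+ 3))) ->
  exists2 C, 0 < C & forall t, 0 <= t -> E t <= C * (1 + t) ^- 2.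
Proof.
(* The first term absorbs the source [8 / k^2 * (1 + t)] left after multiplication by [(1 + t)^4];
   the second makes the monotone quantity nonpositive at time 0. *)
move=> k0 cE dE; pose C := 4 / k ^+ 2 + `|E 0|.
have C0 : 0 < C by rewrite ltr_pwDl// divr_gt0// exprn_gt0.
exists C => // t t0; have u0 : 0 < 1 + t by rewrite ltr_pwDl.
have cp n : (1 + s) ^+ n @[s --> (0 : R)^'+] --> (1 + 0 : R) ^+ n.
  apply: cvg_at_right_filter.
  apply: (@cvg_comp _ _ _ (fun s => 1 + s) (fun x => x ^+ n)); last first.
    exact: exprn_continuous.
  by apply: cvgD; [exact: cvg_cst|exact: cvg_id].
have dp n (x : R) :
    is_derive x 1 (fun s : R => (1 + s) ^+ n) (n%:R * (1 + x) ^+ n.-1).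
  have -> : (fun s : R => (1 + s) ^+ n) = (cst 1 + id) ^+ n.
    by rewrite exprfctE.
  have := is_deriveX n (is_deriveD (is_derive_cst (1 : R) x 1) (is_derive_id x 1)).
  by move/is_derive_eq; apply; rewrite /GRing.scale /= add0r mulr1.
have : E t * (1 + t) ^+ 4 - C * (1 + t) ^+ 2 <=
    E 0 * (1 + 0) ^+ 4 - C * (1 + 0) ^+ 2.
  apply: (@nonincreasing_halfline
    (fun s => E s * (1 + s) ^+ 4 - C * (1 + s) ^+ 2)) t0 => [|x x0].
    by apply: cvgB; apply: cvgM => //; exact: cvg_cst.
  have [dEx dxE H] := dE x x0; have v0 : 0 < 1 + x by rewrite ltr_pwDl// ltW.
  have Dx := is_deriveB (is_deriveM dxE (dp 4 x)) (is_deriveZ C (dp 2 x)).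
  exists (dEx * (1 + x) ^+ 4 + 4 * E x * (1 + x) ^+ 3 - 2 * C * (1 + x)).
    rewrite (_ : _ - _ = E x *: (4 * (1 + x) ^+ 3) + (1 + x) ^+ 4 *: dEx
      - C *: (2 * (1 + x) ^+ 1)); first exact: Dx.
    by rewrite /GRing.scale /=; ring.
  (* For this [s] the coefficient of [E] is [- 4 / (1 + x)], which the derivative of [(1 + x)^4]
     cancels exactly. *)
  have s0 : 0 <= 2 / k / (1 + x) by rewrite !divr_ge0// ltW.
  have := ler_wpM2r (exprn_ge0 4 (ltW v0)) (H _ s0).
  have -> : - (k * (2 * (2 / k / (1 + x)) * E x - (2 / k / (1 + x)) ^+ 3)) *
      (1 + x) ^+ 4 = - (4 * E x * (1 + x) ^+ 3) + 2 * (4 / k ^+ 2) * (1 + x).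
    by field; rewrite !gt_eqF.
  have : 0 <= `|E 0| * (1 + x) by rewrite mulr_ge0// ltW.
  rewrite /C; move: (4 / k ^+ 2) => c; lra.
rewrite addr0 !expr1n !mulr1 => h; rewrite ler_pdivlMr ?exprn_gt0//.
rewrite -(ler_pM2r (exprn_gt0 2 u0)) -mulrA -exprD -subr_le0 (le_trans h)//.
rewrite subr_le0 (le_trans (ler_norm _))// lerDr divr_ge0// exprn_ge0// ltW//.
Qed.

End DifferentialInequalities.

(** * Conservation laws and the two energy bounds for solutions *)

Section Solutions.
Context {R : realType} (e : R) (f0 : R3 R -> R) (f : R -> R3 R -> R).
Hypothesis f_sol : boltzmann_solution e f0 f.

Lemma moment_continuous psi : test_function psi ->
  moment (f t) psi @[t --> 0^'+] --> moment (f 0) psi.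
Proof. by case: f_sol => _ _ H /H[/continuous_within_itvcyP[]]. Qed.

Lemma moment_derive psi (t : R) : test_function psi -> 0 < t ->
  is_derive t 1 (fun s => moment (f s) psi) (weakQ e (f t) psi).
Proof. by case: f_sol => _ _ H /H[_ {}H] /H[]. Qed.

Lemma collision_integrable psi t : test_function psi -> 0 < t ->
  collision_measure.-integrable collision_dom
    (EFin \o collision_integrand e (f t) psi).
Proof. by case: f_sol => _ _ H /H[_ {}H] /H[]. Qed.

(** A collision invariant makes the collision integrand vanish pointwise, so the time derivative is
    zero. *)
Lemma moment_conserved psi : test_function psi ->
  (forall v w n, psi (post1 e v w n) + psi (post2 e v w n) = psi v + psi w) ->
  forall t, 0 <= t -> moment (f t) psi = moment (f 0) psi.
Proof.
move=> tpsi psiE; apply: constant_halfline; first exact: moment_continuous.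
move=> t t0; have := moment_derive tpsi t0.
rewrite (_ : weakQ e (f t) psi = 0)// /weakQ /Rintegral integral0_eq ?mulr0//.
move=> z _ /=; rewrite /collision_integrand psiE.
by rewrite -addrA -opprD subrr mulr0 mul0r.
Qed.

(** The initial datum is attained only almost everywhere, which is enough under the integral
    sign. *)
Lemma initial_moment psi : lebesgue3.-integrable setT (EFin \o f0) ->
  measurable_fun setT psi -> moment (f 0) psi = moment f0 psi.
Proof.
case: f_sol => /(_ 0 (lexx 0))[_ i0 _] ff0 _ if0 mpsi; rewrite /moment /Rintegral.
have mE (g : R3 R -> R) : lebesgue3.-integrable setT (EFin \o g) ->
    measurable_fun setT (fun v => (g v * psi v)%:E).
  move=> /integrableP[/measurable_EFinP mg _].
  exact/measurable_EFinP/measurable_funM.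
congr fine; apply: ae_eq_integral => //; [exact: mE|exact: mE|].
case: ff0 => N [mN N0 sub]; exists N; split=> // v nv.
by apply: sub => /= fv; apply: nv => _ /=; rewrite fv.
Qed.

Hypothesis f0_int : lebesgue3.-integrable setT (EFin \o f0).
Hypothesis f0_mass : mass f0 = 1%E.
Hypothesis f0_momentum : momentum f0 = 0.

Lemma mass_conserved t : 0 <= t -> moment (f t) (fun=> 1) = 1.
Proof.
move=> t0; rewrite (moment_conserved (test_cst _)) ?initial_moment//.
rewrite /moment /Rintegral; under eq_integral do rewrite mulr1.
by move: f0_mass; rewrite /mass => ->.
Qed.

Lemma momentum_conserved t i : 0 <= t -> moment (f t) (coord3 i) = 0.
Proof.
move=> t0; rewrite (moment_conserved (test_coord3 _)) ?initial_moment//.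
- by move: f0_momentum => []; case: i => [[|[|[|//]]] ?].
- exact: measurable_coord3.
- exact: post_coord3.
Qed.

Hypothesis e01 : 0 < e < 1.

Lemma energy_upper : exists2 C, 0 < C &
  forall t, 0 <= t -> moment (f t) (@sqnorm3 R) <= C * (1 + t) ^- 2.
Proof.
case/andP: (e01) => e0 e1.
apply: (@cubic_decay_upper _ _ ((1 - e ^+ 2) / 2)).
- by rewrite divr_gt0// subr_gt0 expr_lt1// ltW.
- exact/moment_continuous/test_sqnorm3.
move=> t t0; exists (weakQ e (f t) (@sqnorm3 R)).
  exact: moment_derive test_sqnorm3 t0.
move=> s s0; have [/(_ t (ltW t0))[ft0 fti ftE] _ _] := f_sol.
apply: weakQ_sqnorm3_le => //.
- exact: mass_conserved (ltW t0).
- by move=> i; exact: momentum_conserved (ltW t0).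
- exact: collision_integrable test_sqnorm3 t0.
Qed.

Lemma energy_lower : exists2 c, 0 < c &
  forall t, 0 <= t -> c * (1 + t) ^- 2 <= moment (f t) (@sqnorm3 R).
Proof.
have [dens _ _] := f_sol.
have norm_gt0 t : 0 <= t -> 0 < moment (f t) (regnorm3 0).
  move=> t0; have [? ? ?] := dens t t0.
  by apply: moment_norm_gt0 => //; exact: mass_conserved.
set m0 := moment (f 0) (regnorm3 0); have m00 : 0 < m0 by exact: norm_gt0.
(* The Riccati bound gives at most [m0^-1 + 8 * t <= K * (1 + t)] for the inverse moment. Using the
   unregularised [m0], which is the smaller moment, makes [K] independent of [d]. *)
pose K := m0^-1 + 8; have K0 : 0 < K by rewrite addr_gt0// invr_gt0.
exists (K ^- 2); first by rewrite invr_gt0 exprn_gt0.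
move=> t t0; have u0 : 0 < 1 + t by rewrite ltr_pwDl.
rewrite -invfM -exprMn; apply/ler_addgt0Pr => eps eps0.
(* The regularisation costs [d^2] in the Cauchy-Schwarz step, which is exactly the allowed error
   [eps]. *)
pose d := Num.sqrt eps; have d0 : 0 < d by rewrite sqrtr_gt0.
have dd : d ^+ 2 = eps by rewrite sqr_sqrtr// ltW.
have moment_gt0 s : 0 <= s -> 0 < moment (f s) (regnorm3 d).
  move=> s0; have [? ? ?] := dens s s0.
  by apply: lt_le_trans (norm_gt0 s s0) _; exact: moment_norm_le.
have [ft0 fti ftE] := dens t t0.
have := sqr_moment_regnorm3_le ft0 fti ftE (mass_conserved t0) d0.
rewrite dd [eps + _]addrC; apply: le_trans.
have : (moment (f t) (regnorm3 d))^-1 <= K * (1 + t).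
  have := @riccati_lower _ (fun s => moment (f s) (regnorm3 d)) 8 _ _ _ t t0.
  move=> /(_ (moment_continuous (test_regnorm3 d0)) moment_gt0) H.
  apply: le_trans (H _) _ => [s s0|].
    exists (weakQ e (f s) (regnorm3 d)).
      exact: moment_derive (test_regnorm3 d0) s0.
    have [fs0 fsi fsE] := dens s (ltW s0).
    apply: weakQ_regnorm3_ge => //.
    exact: collision_integrable (test_regnorm3 d0) s0.
  have : (moment (f 0) (regnorm3 d))^-1 <= m0^-1.
    have [? ? ?] := dens 0 (lexx 0); rewrite lef_pV2 ?posrE ?moment_gt0//.
    exact: moment_norm_le.
  have : 0 <= m0^-1 * t by rewrite mulr_ge0// invr_ge0 ltW.
  rewrite /K; lra.
rewrite -lef_pV2 ?posrE ?invr_gt0 ?mulr_gt0 ?moment_gt0// invrK => h.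
by rewrite -exprVn ler_pXn2r// ?nnegrE ?invr_ge0 ?mulr_ge0// ltW// moment_gt0.
Qed.

End Solutions.

Theorem theorem1p8 (R : realType) (e : R) (f0 : R3 R -> R)
    (f : R -> R3 R -> R)
    (f0_int : lebesgue3.-integrable setT (EFin \o f0))
    (f0_ge0 : forall v, 0 <= f0 v)
    (f0_mass : mass f0 = 1%E)
    (f0_momentum : momentum f0 = 0)
    (f0_energy : (energy f0 < +oo)%E)
    (e_gt0 : 0 < e) (e_lt1 : e < 1)
    (e_small : 3 * (1 - e ^+ 2) / 8 < 1 - kappa32 R)
    (f_sol : boltzmann_solution e f0 f) :
  exists c C : R, [/\ 0 < c, 0 < C &
    forall t : R, 0 <= t ->
      ((c * (1 + t) ^- 2)%:E <= energy (f t))%E /\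
      (energy (f t) <= (C * (1 + t) ^- 2)%:E)%E].
Proof.
have e01 : 0 < e < 1 by rewrite e_gt0.
have [c c0 lower] := energy_lower f_sol f0_int f0_mass.
have [C C0 upper] := energy_upper f_sol f0_int f0_mass f0_momentum e01.
exists c, C; split=> // t t0; have [/(_ t t0)[ft0 fti ftE] _ _] := f_sol.
(* Finiteness of the energy turns the extended-real bounds into the real ones already proved. *)
by rewrite energyE// !lee_fin lower ?upper.
Qed.
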